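(* Let $T(\omega,\eta)=\{u,v\}$ be a set of twins in $X$ ($u\neq v$), and let $\theta=\alpha+\beta\deg(u)+\gamma(\omega-\eta)$ if $M=\mathbf{A}$, and $\theta=\alpha+\frac{\gamma(\omega-\eta)}{\deg(u)}$ if $M=\mathcal{A}$ (an eigenvalue of $M$ with eigenvector $\mathbf{e}_u-\mathbf{e}_v$). If $\Omega$ is an orthogonal basis of (real) eigenvectors for the eigenspace of $\theta$ such that $\mathbf{e}_u-\mathbf{e}_v\in\Omega$, then $u$ and $v$ are strongly cospectral with respect to $M$ if and only if either $|\Omega|=1$ or $\mathbf{w}^T\mathbf{e}_u=\mathbf{w}^T\mathbf{e}_v=0$ for all $\mathbf{w}\in\Omega\setminus\{\mathbf{e}_u-\mathbf{e}_v\}$. Moreover, if $u$ and $v$ are strongly cospectral with respect to $M$, then $\sigma_{uv}^-(M)=\{\theta\}$, $\sigma_{uv}^+(M)=\sigma_u(M)\setminus\{\theta\}$, and $u$ and $v$ cannot be strongly cospectral with any $w\in V(X)\setminus\{u,v\}$.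
   Context: $X$ is a finite connected undirected graph with nonzero real edge weights, loops allowed, no multiple edges. $A$ is its adjacency matrix: $(A)_{j,\ell}$ is the weight of the edge $(j,\ell)$ (for $j=\ell$, the weight of the loop at $j$), and $0$ if there is no such edge. $\deg(u)=2(A)_{u,u}+\sum_{j\neq u}(A)_{u,j}$ and $D$ is the diagonal matrix of degrees. $\mathbf{e}_u$ is the characteristic vector of $u$. Fix real $\alpha,\beta,\gamma$ with $\gamma\neq0$. The generalized adjacency matrix is $\mathbf{A}=\alpha I+\beta D+\gamma A$. If all vertex degrees are positive or all are negative, the generalized normalized adjacency matrix is $\mathcal{A}=\alpha I+\gamma D^{-1/2}AD^{-1/2}$, where $D^{-1/2}$ is diagonal with $(D^{-1/2})_{u,u}=1/\sqrt{\deg(u)}$ if $\deg(u)>0$ and $-i/\sqrt{|\deg(u)|}$ if $\deg(u)<0$. $M$ denotes $\mathbf{A}$ or, when it is defined, $\mathcal{A}$; both are real symmetric. Let $M=\sum_j\lambda_jE_j$ be the spectral decomposition ($\lambda_j$ distinct eigenvalues, $E_j$ orthogonal projections onto the eigenspaces). $\sigma_u(M)=\{\lambda_j:E_j\mathbf{e}_u\neq0\}$. Vertices $u,v$ are strongly cospectral with respect to $M$ if $E_j\mathbf{e}_u=\pm E_j\mathbf{e}_v$ for each $j$; in that case $\sigma_{uv}^{+}(M)=\{\lambda_j\in\sigma_u(M):E_j\mathbf{e}_u=E_j\mathbf{e}_v\}$ and $\sigma_{uv}^{-}(M)=\{\lambda_j\in\sigma_u(M):E_j\mathbf{e}_u=-E_j\mathbf{e}_v\}$.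 A set of twins $T=T(\omega,\eta)$, with $\omega,\eta\in\mathbb{R}$, is a set $T\subseteq V(X)$ such that any two vertices of $T$ are twins, each vertex of $T$ has a loop of weight $\omega$ (no loop if $\omega=0$), and every two distinct vertices of $T$ are joined by an edge of weight $\eta$ (not adjacent if $\eta=0$). Distinct vertices $u,v$ are twins if they have the same neighbours outside $\{u,v\}$, $(A)_{u,w}=(A)_{v,w}$ for every $w\neq u,v$, and $(A)_{u,u}=(A)_{v,v}$. ($T$ need not be a maximal set of twins.) *)

(* Defs.v *)
From HB Require Import structures.
From mathcomp Require Import all_boot all_order all_algebra.
From mathcomp Require Import complex.
Set Implicit Arguments.
Unset Strict Implicit.
Unset Printing Implicit Defensive.
Import Order.TTheory GRing.Theory Num.Theory.
Local Open Scope ring_scope.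
Local Open Scope complex_scope.

(* MathComp (real scalars: an arbitrary real closed field R).                 *)
(* Vectors are row vectors and matrices act on the right; all the matrices M  *)
(* considered are symmetric (genadj_sym, normadj_sym), so that x *m M is the  *)
(* transpose of M *m x^T and eigenspace M l is the usual eigenspace.          *)

(* Loops are the j with edge j j; values of weight outside edge are junk.     *)
Record wgraph (R : rcfType) (n : nat) := WGraph {
  edge : rel 'I_n;
  weight : 'I_n -> 'I_n -> R;
  edgeC : forall j l, edge j l = edge l j;
  weightC : forall j l, weight j l = weight l j;
  weight_neq0 : forall j l, edge j l -> weight j l != 0;
  edge_connected : forall j l, connect edge j l
}.

Section Graph.
Variables (R : rcfType) (n : nat) (X : wgraph R n).

Definition adjmx : 'M[R]_n :=
  \matrix_(j, l) if edge X j l then weight X j l else 0.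

Definition deg (u : 'I_n) : R :=
  2 * adjmx u u + \sum_(j | j != u) adjmx u j.

Definition degmx : 'M[R]_n := diag_mx (\row_u deg u).

Definition genadj (alpha beta gamma : R) : 'M[R]_n :=
  alpha%:M + beta *: degmx + gamma *: adjmx.

Definition definite_degs : Prop :=
  (forall u, 0 < deg u) \/ (forall u, deg u < 0).

Definition invsqrt_degmx : 'M[R[i]]_n :=
  diag_mx (\row_u if 0 < deg u then 1 / (Num.sqrt (deg u))%:C
                  else - 'i / (Num.sqrt `|deg u|)%:C).

Definition cnormadj (alpha gamma : R) : 'M[R[i]]_n :=
  alpha%:C%:M +
  gamma%:C *: (invsqrt_degmx *m map_mx (real_complex R) adjmx *m invsqrt_degmx).

(* When definite_degs holds, cnormadj has real entries (normadjE) and normadj *)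
(* is that matrix seen over R; otherwise normadj is junk.                     *)
Definition normadj (alpha gamma : R) : 'M[R]_n :=
  map_mx (@complex.Re R) (cnormadj alpha gamma).

Definition twins (u v : 'I_n) : Prop :=
  [/\ u != v,
      forall w, w != u -> w != v -> edge X u w = edge X v w,
      forall w, w != u -> w != v -> adjmx u w = adjmx v w
    & adjmx u u = adjmx v v].

Definition joined_with_weight (j l : 'I_n) (c : R) : Prop :=
  if c == 0 then ~~ edge X j l else edge X j l && (weight X j l == c).

Definition twin_set (T : {set 'I_n}) (omega eta : R) : Prop :=
  [/\ {in T &, forall u v, u != v -> twins u v},
      {in T, forall u, joined_with_weight u u omega}
    & {in T &, forall u v, u != v -> joined_with_weight u v eta}].

End Graph.

Section Spectral.
Variables (R : rcfType) (n : nat).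
Implicit Types (M : 'M[R]_n) (u v : 'I_n) (l : R).

Definition evec u : 'rV[R]_n := delta_mx 0 u.

Definition dot (x y : 'rV[R]_n) : R := (x *m y^T) 0 0.

(* Orthogonal projection onto the l-eigenspace of M, i.e. projection along    *)
(* its orthogonal complement: the row space of kermx U^T is                   *)
(* {x | x *m U^T = 0}. It is 0 if l is not an eigenvalue.                     *)
Definition eigproj M l : 'M[R]_n :=
  proj_mx (eigenspace M l) (kermx (eigenspace M l)^T).

Definition esupp M u : {pred R} :=
  [pred l | eigenvalue M l && (evec u *m eigproj M l != 0)].

Definition strongly_cospectral M u v : Prop :=
  forall l, eigenvalue M l ->
    evec u *m eigproj M l = evec v *m eigproj M l \/
    evec u *m eigproj M l = - (evec v *m eigproj M l).

Definition esupp_plus M u v : {pred R} :=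
  [pred l | (l \in esupp M u) &&
            (evec u *m eigproj M l == evec v *m eigproj M l)].

Definition esupp_minus M u v : {pred R} :=
  [pred l | (l \in esupp M u) &&
            (evec u *m eigproj M l == - (evec v *m eigproj M l))].

(* Omega, a finite set given as a list, is an orthogonal basis of the row     *)
(* space of U (row_free forces the list to be duplicate-free).                *)
Definition orthogonal_basis (U : 'M[R]_n) (Omega : seq 'rV[R]_n) : Prop :=
  let B := \matrix_(i < size Omega) Omega`_i in
  [/\ row_free B, (B == U)%MS
    & {in Omega &, forall x y, x != y -> dot x y = 0}].

End Spectral.

Section Sanity.
Variables (R : rcfType) (n : nat).

Lemma adjmx_sym (X : wgraph R n) : (adjmx X)^T = adjmx X.
Proof. by apply/matrixP=> j l; rewrite !mxE edgeC weightC. Qed.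

Lemma genadj_sym (X : wgraph R n) a b c : (genadj X a b c)^T = genadj X a b c.
Proof.
by rewrite /genadj !linearD /= !linearZ /= tr_scalar_mx tr_diag_mx adjmx_sym.
Qed.

Lemma normadj_sym (X : wgraph R n) a c : (normadj X a c)^T = normadj X a c.
Proof.
rewrite /normadj matrix.map_trmx; congr map_mx; rewrite /cnormadj.
rewrite linearD /= linearZ /= tr_scalar_mx !trmx_mul tr_diag_mx.
by rewrite matrix.map_trmx adjmx_sym mulmxA.
Qed.

Lemma normadjE (X : wgraph R n) a c : definite_degs X ->
  map_mx (real_complex R) (normadj X a c) = cnormadj X a c.
Proof.
move=> dX; apply/matrixP=> j l.
suff [r E]: exists r : R, cnormadj X a c j l = r%:C.
  by rewrite /normadj [LHS]mxE mxE E.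
rewrite /cnormadj /invsqrt_degmx mul_mx_diag mul_diag_mx !mxE.
set A := if edge X j l then _ else _.
suff [s ->]: exists s : R, (if 0 < deg X j then 1 / (Num.sqrt (deg X j))%:C
      else - 'i / (Num.sqrt `|deg X j|)%:C) * A%:C *
     (if 0 < deg X l then 1 / (Num.sqrt (deg X l))%:C
      else - 'i / (Num.sqrt `|deg X l|)%:C) = s%:C.
  by exists (a *+ (j == l) + c * s); rewrite rmorphD rmorphM rmorphMn.
have ii : (- 'i : R[i]) * - 'i = (-1)%:C.
  by rewrite mulrNN -expr2 sqr_i rmorphN1.
case: dX => dX.
  rewrite !dX !div1r -!fmorphV -!rmorphM; eexists; reflexivity.
rewrite !ltNge !ltW //= -!fmorphV mulrAC mulrACA ii -!rmorphM.
eexists; reflexivity.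
Qed.

Lemma cap_eigenspace_orth (M : 'M[R]_n) l :
  (eigenspace M l :&: kermx (eigenspace M l)^T = 0)%MS.
Proof.
apply/eqP; rewrite -submx0; apply/row_subP=> i; set y := row _ _.
have: (y <= eigenspace M l :&: kermx (eigenspace M l)^T)%MS by apply: row_sub.
rewrite sub_capmx => /andP[/submxP[z yE] /sub_kermxP yK].
have: y *m y^T = 0 by rewrite {2}yE trmx_mul mulmxA yK mul0mx.
move/matrixP/(_ 0 0); rewrite !mxE => /eqP.
rewrite psumr_eq0 => [/allP y0|j _]; last by rewrite [y^T _ _]mxE -expr2 sqr_ge0.
rewrite submx0; apply/eqP/rowP=> j; have := y0 j (mem_index_enum j).
by rewrite [y^T _ _]mxE [RHS]mxE mulf_eq0 orbb => /eqP.
Qed.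

Lemma eigproj_sub (M : 'M[R]_n) l (x : 'rV_n) :
  (x *m eigproj M l <= eigenspace M l)%MS.
Proof. exact: proj_mx_sub. Qed.

Lemma eigproj_orth (M : 'M[R]_n) l (x y : 'rV_n) :
  (y <= eigenspace M l)%MS -> dot (x - x *m eigproj M l) y = 0.
Proof.
set U := eigenspace M l => /submxP[z ->].
have full: row_full (U + kermx U^T)%MS.
  have := mxrank_disjoint_sum (cap_eigenspace_orth M l).
  rewrite -/U mxrank_ker mxrank_tr subnKC ?rank_leq_row // => r.
  by rewrite /row_full r.
have /sub_kermxP K : (x - x *m eigproj M l <= kermx U^T)%MS.
  by apply: proj_mx_compl_sub; apply: submx_full.
by rewrite /dot trmx_mul mulmxA K mul0mx mxE.
Qed.

End Sanity.

(* Main.v *)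
Require Import Defs.
From HB Require Import structures.
From mathcomp Require Import all_boot all_order all_algebra.
From mathcomp Require Import complex.
From mathcomp Require Import ring.
Set Implicit Arguments.
Unset Strict Implicit.
Unset Printing Implicit Defensive.
Import Order.TTheory GRing.Theory Num.Theory.
Local Open Scope ring_scope.

(** Let [d = e_u - e_v].  Exchanging the twins [u] and [v] leaves the graph
unchanged, and for both matrices this makes [d] an eigenvector for [theta]
([eigen_genadj], [eigen_normadj]).  Everything else is linear algebra about a
symmetric [M] with such an eigenvector.

Eigenspaces for distinct eigenvalues are orthogonal, so [d] projects to [0] on
every eigenspace except the one of [theta], where it is fixed.  Hence
[e_u E_l = e_v E_l] for [l != theta], while [e_u E_theta = e_v E_theta] is
impossible.  Strong cospectrality therefore amounts to the one condition
[(e_u + e_v) E_theta = 0] ([strongly_cospectralP]), that is, to [e_u + e_v]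
being orthogonal to the eigenspace of [theta] ([eigproj_eq0P]).  This can be
tested on the basis [Omega]: [d] passes, and any other [w] in [Omega] is
orthogonal to [d], so [w_u = w_v], and it passes exactly when [w_u] and [w_v]
both vanish.

When the condition holds, [e_u E_theta = d / 2] and [e_v E_theta = - d / 2],
which gives the signed supports.  For a third vertex [w], the projection
[e_w E_theta] is orthogonal to [d] because [e_w] is, so it cannot be
[e_u E_theta] or [e_v E_theta] up to sign. *)

(** * Orthogonality and spectral projections *)

Section EigenProjection.
Variables (R : rcfType) (n : nat).
Implicit Types (M U : 'M[R]_n) (x y z : 'rV[R]_n) (l : R) (u : 'I_n).

Lemma dotC x y : dot x y = dot y x.
Proof.
by rewrite /dot !mxE; apply: eq_bigr => j _; rewrite !mxE mulrC.
Qed.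

Lemma dotDl x y z : dot (x + y) z = dot x z + dot y z.
Proof. by rewrite /dot mulmxDl mxE. Qed.

Lemma dotNl x y : dot (- x) y = - dot x y.
Proof. by rewrite /dot mulNmx mxE. Qed.

Lemma dotBl x y z : dot (x - y) z = dot x z - dot y z.
Proof. by rewrite dotDl dotNl. Qed.

Lemma dotZl a x y : dot (a *: x) y = a * dot x y.
Proof. by rewrite /dot -scalemxAl mxE. Qed.

Lemma dot_evec x u : dot x (evec R u) = x 0 u.
Proof. by rewrite /dot /evec trmx_delta -colE mxE. Qed.

Lemma evecE u (j : 'I_n) : evec R u 0 j = (j == u)%:R :> R.
Proof. by rewrite mxE. Qed.

Lemma dot_eq0 x : dot x x = 0 -> x = 0.
Proof.
rewrite /dot mxE => /eqP; rewrite psumr_eq0 => [/allP x0|j _]; last first.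
  by rewrite mxE -expr2 sqr_ge0.
apply/rowP=> j; have := x0 j (mem_index_enum j).
by rewrite !mxE mulf_eq0 orbb => /eqP.
Qed.

Lemma eigproj_id M l x : (x <= eigenspace M l)%MS -> x *m eigproj M l = x.
Proof. exact: proj_mx_id (cap_eigenspace_orth M l). Qed.

(** [x] and its projection have the same products with all vectors of the
eigenspace; the projection is one of these, and is [0] if its square is. *)
Lemma eigproj_eq0P M l x :
  x *m eigproj M l = 0 <->
  (forall y, (y <= eigenspace M l)%MS -> dot x y = 0).
Proof.
split=> [x0 y /(eigproj_orth x)|x0]; first by rewrite x0 subr0.
have := eigproj_orth x (eigproj_sub M l x).
rewrite dotBl x0 ?eigproj_sub // sub0r => /eqP.
by rewrite oppr_eq0 => /eqP/dot_eq0.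
Qed.

Lemma eigenspace_orth M l m x y : M^T = M -> l != m ->
  (x <= eigenspace M l)%MS -> (y <= eigenspace M m)%MS -> dot x y = 0.
Proof.
move=> symM lm /eigenspaceP xl /eigenspaceP ym; apply/eqP.
have : (l - m) * dot x y == 0.
  rewrite mulrBl -dotZl -xl [_ * dot _ _]mulrC [dot x y]dotC mulrC -dotZl -ym.
  by rewrite [X in _ - X]dotC /dot trmx_mul symM mulmxA subrr.
by rewrite mulf_eq0 subr_eq0 (negPf lm).
Qed.

Lemma orthogonal_basis_orthP U (Omega : seq 'rV[R]_n) x :
  orthogonal_basis U Omega ->
  (forall y, (y <= U)%MS -> dot x y = 0) <-> {in Omega, forall w, dot x w = 0}.
Proof.
case=> _ /andP[BU UB] _; split=> [x0 w wO|x0 y yU].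
  apply: x0; apply: submx_trans BU.
  have iO : (index w Omega < size Omega)%N by rewrite index_mem.
  suff -> : w = row (Ordinal iO) (\matrix_(i < size Omega) Omega`_i).
    exact: row_sub.
  by rewrite rowK nth_index.
have /submxP[c ->] := submx_trans yU UB.
rewrite dotC /dot -mulmxA; set z := _ *m x^T; suff -> : z = 0 by rewrite mulmx0 mxE.
apply/row_matrixP=> i; rewrite /z row_mul rowK row0.
by apply/rowP=> j; rewrite ord1 [RHS]mxE -/(dot _ _) dotC x0 ?mem_nth.
Qed.

End EigenProjection.

(** * Symmetric matrices with eigenvector [e_u - e_v] *)

Section DifferenceEigenvector.
Variables (R : rcfType) (n : nat) (M : 'M[R]_n) (theta : R) (u v : 'I_n).
Hypotheses (symM : M^T = M) (uv : u != v).
Hypothesis eigen_uv : (evec R u - evec R v <= eigenspace M theta)%MS.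

Let d := evec R u - evec R v.

Lemma dot_diff_evec x : dot x d = x 0 u - x 0 v.
Proof. by rewrite dotC dotBl dotC dot_evec dotC dot_evec. Qed.

Lemma diff_evec_neq0 : d != 0.
Proof.
apply/eqP=> /rowP/(_ u); rewrite !mxE !eqxx (negPf uv) subr0.
by move/eqP; rewrite oner_eq0.
Qed.

Lemma diff_evec_eigenvalue : eigenvalue M theta.
Proof. by apply/eigenvalueP; exists d; [apply/eigenspaceP | exact: diff_evec_neq0]. Qed.

Lemma eigproj_eq l : l != theta ->
  evec R u *m eigproj M l = evec R v *m eigproj M l.
Proof.
move=> lt; apply/eqP; rewrite -subr_eq0 -mulmxBl; apply/eqP/eigproj_eq0P=> y yl.
by apply: eigenspace_orth eigen_uv yl => //; rewrite eq_sym.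
Qed.

Lemma eigproj_neq : evec R u *m eigproj M theta != evec R v *m eigproj M theta.
Proof. by rewrite -subr_eq0 -mulmxBl eigproj_id // diff_evec_neq0. Qed.

(** The plus sign is impossible at [theta] and automatic at every other
eigenvalue, so only the minus sign at [theta] is left to ask for. *)
Lemma strongly_cospectralP :
  strongly_cospectral M u v <-> (evec R u + evec R v) *m eigproj M theta = 0.
Proof.
split=> [/(_ _ diff_evec_eigenvalue)[/eqP|uvN]|uvN l _].
- by rewrite (negPf eigproj_neq).
- by rewrite mulmxDl uvN addNr.
have [->|/eigproj_eq ->] := eqVneq l theta; last by left.
by right; apply/eqP; rewrite -addr_eq0 -mulmxDl uvN.
Qed.

Lemma eigproj_opp : strongly_cospectral M u v ->
  evec R u *m eigproj M theta = - (evec R v *m eigproj M theta).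
Proof.
by move/strongly_cospectralP; rewrite mulmxDl => /eqP; rewrite addr_eq0 => /eqP.
Qed.

Lemma eigproj_neq0 : strongly_cospectral M u v ->
  evec R u *m eigproj M theta != 0.
Proof.
move=> /eigproj_opp uvN; apply: contra_neq eigproj_neq => u0.
by apply/esym/eqP; rewrite u0 -oppr_eq0 -uvN u0.
Qed.

(** [e_u + e_v] is orthogonal to [w] when [w_u + w_v = 0]; for [w] in the basis
other than [d], orthogonality to [d] gives [w_u = w_v] as well.  If [d] is the
whole basis, there is no such [w]. *)
Lemma strongly_cospectral_basisP (Omega : seq 'rV[R]_n) :
  orthogonal_basis (eigenspace M theta) Omega -> d \in Omega ->
  strongly_cospectral M u v <->
  (size Omega = 1%N \/
   forall w, w \in Omega -> w != d ->
     dot w (evec R u) = 0 /\ dot w (evec R v) = 0).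
Proof.
move=> basO dO; have spanP := orthogonal_basis_orthP (evec R u + evec R v) basO.
have sumE w : dot (evec R u + evec R v) w = w 0 u + w 0 v.
  by rewrite dotDl dotC dot_evec dotC dot_evec.
split=> [/strongly_cospectralP/eigproj_eq0P/spanP sum0|dO_or].
  right=> w wO wd; rewrite !dot_evec.
  have [_ _ /(_ _ _ wO dO wd)] := basO.
  rewrite dot_diff_evec => /eqP; rewrite subr_eq0 => /eqP wuv.
  have := sum0 _ wO; rewrite sumE wuv -mulr2n => /eqP.
  by rewrite mulrn_eq0 => /eqP ->.
apply/strongly_cospectralP/eigproj_eq0P/spanP=> w wO; rewrite sumE.
have [->|wd] := eqVneq w d.
  rewrite !mxE !eqxx [v == u]eq_sym (negPf uv) /=.
  by ring.
case: dO_or => [O1|/(_ _ wO wd)[]]; last by rewrite !dot_evec => -> ->; rewrite addr0.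
case: Omega O1 dO wO {basO spanP} => [|x [|]] //= _.
by rewrite !inE => /eqP <- /eqP wd'; rewrite wd' eqxx in wd.
Qed.

Lemma esupp_minus_diff : strongly_cospectral M u v ->
  esupp_minus M u v =i pred1 theta.
Proof.
move=> sc l; rewrite !inE; have [->|lt] := eqVneq l theta.
  by rewrite diff_evec_eigenvalue eigproj_neq0 //=; apply/eqP/eigproj_opp.
apply/negbTE/negP=> /andP[/andP[_ /negP u0]].
rewrite -eigproj_eq // -addr_eq0 -mulr2n -scaler_nat scaler_eq0 pnatr_eq0 /=.
exact: u0.
Qed.

Lemma esupp_plus_diff : esupp_plus M u v =i [predD1 esupp M u & theta].
Proof.
move=> l; rewrite !inE andbC; have [->|lt] := eqVneq l theta.
  by rewrite (negPf eigproj_neq).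
by rewrite eigproj_eq // eqxx.
Qed.

(** Since [d] lies in the eigenspace, projecting [e_w] does not change its
product with [d]. *)
Lemma dot_eigproj_diff w :
  dot (evec R w *m eigproj M theta) d = (w == u)%:R - (w == v)%:R.
Proof.
have /eqP := eigproj_orth (evec R w) eigen_uv.
rewrite dotBl subr_eq0 => /eqP <-.
by rewrite dot_diff_evec !evecE eq_sym [v == w]eq_sym.
Qed.

Lemma not_strongly_cospectral_diff x w :
  x \in [:: u; v] -> w != u -> w != v -> ~ strongly_cospectral M x w.
Proof.
move=> xuv wu wv /(_ _ diff_evec_eigenvalue) sc.
have w0 : dot (evec R w *m eigproj M theta) d = 0.
  by rewrite dot_eigproj_diff (negPf wu) (negPf wv) subrr.
have x0 : dot (evec R x *m eigproj M theta) d = 0.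
  by case: sc => ->; rewrite ?dotNl w0 ?oppr0.
move: x0; rewrite dot_eigproj_diff; move: xuv; rewrite !inE => /orP[]/eqP->.
  by rewrite eqxx (negPf uv) subr0 => /eqP; rewrite oner_eq0.
by rewrite eqxx eq_sym (negPf uv) sub0r => /eqP; rewrite oppr_eq0 oner_eq0.
Qed.

End DifferenceEigenvector.

(** * The eigenvector of a pair of twins *)

Lemma diff_evec_eigenP (R : rcfType) n (M : 'M[R]_n) theta (u v : 'I_n) :
  (forall j, M u j - M v j = theta * ((j == u)%:R - (j == v)%:R)) ->
  (evec R u - evec R v <= eigenspace M theta)%MS.
Proof.
move=> rows; apply/eigenspaceP/rowP=> j.
by rewrite mulmxBl -!rowE !mxE rows.
Qed.

Section Twins.
Variables (R : rcfType) (n : nat) (X : wgraph R n).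
Variables (u v : 'I_n) (omega eta : R).
Hypotheses (uv : u != v) (T_uv : twin_set X [set u; v] omega eta).

Local Notation A := (adjmx X).

Lemma adjmxC j l : A j l = A l j.
Proof. by rewrite -[in LHS]adjmx_sym mxE. Qed.

Lemma joined_adjmx j l c : joined_with_weight X j l c -> A j l = c.
Proof.
rewrite /joined_with_weight mxE; case: eqP => [-> /negPf -> //|_].
by case/andP=> -> /eqP.
Qed.

Lemma adjmx_twins : [/\ A u u = omega, A v v = omega & A u v = eta].
Proof.
have [_ loops edges] := T_uv.
by split; apply: joined_adjmx; [apply: loops|apply: loops|apply: edges];
  rewrite ?inE ?eqxx ?orbT.
Qed.

Lemma adjmx_twins_out j : j != u -> j != v -> A u j = A v j.
Proof.
have [tw _ _] := T_uv; have [||_ _ + _] := tw u v _ _ uv.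
- by rewrite !inE eqxx.
- by rewrite !inE eqxx orbT.
exact.
Qed.

(** The difference of the rows of twins is a multiple of [d]; this is what makes
[d] an eigenvector, the diagonal terms being equal at [u] and [v]. *)
Lemma adjmx_diff j : A u j - A v j = (omega - eta) * ((j == u)%:R - (j == v)%:R).
Proof.
have [Auu Avv Auv] := adjmx_twins.
have [->|ju] := eqVneq j u.
  by rewrite (negPf uv) [A v u]adjmxC Auu Auv subr0 mulr1.
have [->|jv] := eqVneq j v; first by rewrite Avv Auv sub0r mulrN1 opprB.
by rewrite adjmx_twins_out // !subrr mulr0.
Qed.

Lemma deg_twins : deg X u = deg X v.
Proof.
have [Auu Avv Auv] := adjmx_twins.
rewrite /deg (bigD1 v) 1?eq_sym //= [in RHS](bigD1 u) //= Auu Avv [A v u]adjmxC.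
congr (_ + (_ + _)); rewrite (eq_bigl (fun j => (j != v) && (j != u))).
  by apply: eq_bigr => j /andP[jv ju]; apply: adjmx_twins_out.
by move=> j; rewrite andbC.
Qed.

Lemma genadj_entry alpha beta gamma j l :
  genadj X alpha beta gamma j l =
  alpha *+ (j == l) + beta * (deg X j *+ (j == l)) + gamma * A j l.
Proof.
rewrite /genadj /degmx; move: A => B; rewrite !mxE.
by case: eqP => [->|].
Qed.

Lemma eigen_genadj alpha beta gamma :
  (evec R u - evec R v <=
   eigenspace (genadj X alpha beta gamma)
     (alpha + beta * deg X u + gamma * (omega - eta)))%MS.
Proof.
apply: diff_evec_eigenP => j.
rewrite mulrDl -[gamma * _ * _]mulrA -adjmx_diff !genadj_entry -deg_twins.
rewrite [u == j]eq_sym [v == j]eq_sym.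
by case: (j == u); case: (j == v); rewrite ?mulr1n ?mulr0n; ring.
Qed.

Local Notation s := (fun j : 'I_n => invsqrt_degmx X j j).

(** The factor [- i] of the scaling for a negative degree squares to the sign of
that degree. *)
Lemma invsqrt_deg_sqr j : deg X j != 0 -> s j * s j = real_complex R (deg X j)^-1.
Proof.
move=> dj; rewrite /invsqrt_degmx !mxE eqxx mulr1n; have [dj0|dj0] := ltP 0 (deg X j).
  by rewrite div1r -invfM -rmorphM -expr2 sqr_sqrtr ?ltW // fmorphV.
rewrite mulrACA mulrNN -expr2 sqr_i -invfM -rmorphM -expr2 sqr_sqrtr //.
by rewrite ler0_norm // rmorphN invrN mulrNN mul1r fmorphV.
Qed.

Lemma normadj_entry alpha gamma j l :
  normadj X alpha gamma j l =
  alpha *+ (j == l) + gamma * (A j l * complex.Re (s j * s l)).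
Proof.
rewrite /normadj /cnormadj /invsqrt_degmx mul_mx_diag mul_diag_mx.
move: A => B; rewrite !mxE !eqxx !mulr1n.
move: (if _ then _ else _) (if _ then _ else _) => [xr xi] [yr yi].
by case: (j == l); rewrite /= ?mulr1n ?mulr0n /=; ring.
Qed.

(** Where the rows of the twins differ, at [u] and [v], the scaling factor is
[s u * s u = 1 / deg u]. *)
Lemma eigen_normadj alpha gamma : definite_degs X ->
  (evec R u - evec R v <=
   eigenspace (normadj X alpha gamma)
     (alpha + gamma * (omega - eta) / deg X u))%MS.
Proof.
move=> definite; have du : deg X u != 0.
  by case: definite => /(_ u); [apply: lt0r_neq0|apply: ltr0_neq0].
have suv : s v = s u by rewrite /invsqrt_degmx !mxE !eqxx deg_twins.
apply: diff_evec_eigenP => j; rewrite !normadj_entry suv.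
have scaled : (A u j - A v j) * complex.Re (s u * s j) =
              (omega - eta) / deg X u * ((j == u)%:R - (j == v)%:R).
  rewrite adjmx_diff mulrAC.
  have [juv|] := boolP (j \in [:: u; v]).
    have -> : s j = s u by move: juv; rewrite !inE => /orP[]/eqP->.
    by rewrite invsqrt_deg_sqr.
  by rewrite !inE negb_or => /andP[/negPf-> /negPf->]; rewrite !subrr !mulr0.
rewrite mulrDl -[gamma * _ / _]mulrA -[gamma * _ * _]mulrA -scaled.
rewrite [u == j]eq_sym [v == j]eq_sym.
by case: (j == u); case: (j == v); rewrite ?mulr1n ?mulr0n; ring.
Qed.

End Twins.

Theorem corollary3p14 (R : rcfType) (n : nat) (X : wgraph R n)
  (alpha beta gamma : R) (gamma_neq0 : gamma != 0)
  (u v : 'I_n) (omega eta : R) (uv : u != v)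
  (T_uv : twin_set X [set u; v] omega eta)
  (M : 'M[R]_n) (theta : R)
  (M_theta :
    (M = genadj X alpha beta gamma /\
     theta = alpha + beta * deg X u + gamma * (omega - eta)) \/
    [/\ definite_degs X, M = normadj X alpha gamma &
     theta = alpha + gamma * (omega - eta) / deg X u]) :
  [/\ eigenvalue M theta /\ (evec R u - evec R v <= eigenspace M theta)%MS,
      forall Omega : seq 'rV[R]_n,
        orthogonal_basis (eigenspace M theta) Omega ->
        evec R u - evec R v \in Omega ->
        (strongly_cospectral M u v <->
         (size Omega = 1%N \/
          forall w : 'rV[R]_n, w \in Omega -> w != evec R u - evec R v ->
            dot w (evec R u) = 0 /\ dot w (evec R v) = 0))
    & strongly_cospectral M u v ->
      [/\ esupp_minus M u v =i pred1 theta,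
          esupp_plus M u v =i [predD1 esupp M u & theta]
        & forall w : 'I_n, w != u -> w != v ->
            ~ strongly_cospectral M u w /\ ~ strongly_cospectral M v w]].
Proof.
have [symM eigen_uv] :
    M^T = M /\ (evec R u - evec R v <= eigenspace M theta)%MS.
  case: M_theta => [[-> ->]|[definite -> ->]].
    by split; [apply: genadj_sym | apply: eigen_genadj].
  by split; [apply: normadj_sym | apply: eigen_normadj].
split; first by split=> //; apply: diff_evec_eigenvalue eigen_uv.
  by move=> Omega; apply: strongly_cospectral_basisP.
move=> sc; split; [exact: esupp_minus_diff|exact: esupp_plus_diff|].
by move=> w wu wv; split; apply: (not_strongly_cospectral_diff uv eigen_uv);
  rewrite ?inE ?eqxx ?orbT.
Qed.
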